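(* Let $(W,w)=\{(W_i,\omega_i)\}_{i\in I_m}$ be a fusion frame for a finite-dimensional Hilbert space $\mathcal{H}$ and let $(V,v)=\{(V_i,\nu_i)\}_{i\in I_m}$ be a dual fusion frame of $(W,w)$. Put $$c_v=\max\{\omega_i\nu_i\|\pi_{V_i}S_W^{-1}\pi_{W_i}\|_F:\ i\in I_m\},\quad \Lambda_{1,v}=\{i\in I_m:\ \omega_i\nu_i\|\pi_{V_i}S_W^{-1}\pi_{W_i}\|_F=c_v\},\quad \Lambda_{2,v}=I_m\setminus\Lambda_{1,v},$$ and $\mathcal{H}_{j,v}=\operatorname{span}\bigcup_{i\in\Lambda_{j,v}}W_i$ for $j=1,2$. If $\{(W_i,\omega_i)\}_{i\in\Lambda_{1,v}}$ is a Riesz fusion basis for $\mathcal{H}_{1,v}$ and $\mathcal{H}_{1,v}\cap\mathcal{H}_{2,v}=\{0\}$, then $(V,v)$ is a $1$-loss optimal dual of $(W,w)$.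
   Context: $I_m=\{1,\dots,m\}$; $\pi_X$ is the orthogonal projection onto a subspace $X$; $\|\cdot\|_F$ is the Frobenius norm. The span of the empty set is $\{0\}$. A family $(W,w)=\{(W_i,\omega_i)\}_{i\in I_m}$ of subspaces of $\mathcal{H}$ with weights $\omega_i>0$ is a fusion frame for $\mathcal{H}$ if $\operatorname{span}\bigcup_iW_i=\mathcal{H}$; its fusion frame operator $S_Wf=\sum_{i\in I_m}\omega_i^2\pi_{W_i}f$ is positive and invertible. Fusion frames are assumed non-trivial: $W_i\ne\mathcal{H}$ for at least one $i$. A family $\{(W_i,\omega_i)\}_{i\in\Lambda}$ is a Riesz fusion basis for a space $\mathcal{K}$ if the $W_i$ span $\mathcal{K}$ and there are constants $0<A\le B$ with $A\sum_{i\in J}\|f_i\|^2\le\|\sum_{i\in J}f_i\|^2\le B\sum_{i\in J}\|f_i\|^2$ for all finite $J\subset\Lambda$ and $f_i\in W_i$. A family $(V,v)=\{(V_i,\nu_i)\}_{i\in I_m}$ of subspaces with weights $\nu_i>0$ is a dual fusion frame of $(W,w)$ if $\sum_{i\in I_m}\omega_i\nu_i\pi_{V_i}S_W^{-1}\pi_{W_i}=I_{\mathcal{H}}$; $D_W$ denotes the set of all of these. $(V,v)\in D_W$ is a $1$-loss optimal dual of $(W,w)$ if $$\max_{i\in I_m}\|\omega_i\nu_i\pi_{V_i}S_W^{-1}\pi_{W_i}\|_F=\inf\Big\{\max_{i\in I_m}\|\omega_iz_i\pi_{Z_i}S_W^{-1}\pi_{W_i}\|_F:(Z,z)\in D_W\Big\}.$$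 *)

(* Defs.v *)
From HB Require Import structures.
From mathcomp Require Import all_boot all_order all_algebra.
From mathcomp Require Import complex.
From mathcomp Require Import boolp classical_sets reals.

Set Implicit Arguments.
Unset Strict Implicit.
Unset Printing Implicit Defensive.

Import Order.TTheory GRing.Theory Num.Theory.

Local Open Scope ring_scope.

(* A finite-dimensional Hilbert space is a [vectType] over K = R or K = R[i]
   with a positive definite form [ip : {dot H for conjS R k}], linear in its
   first argument and conjugate-linear in the second; [k] selects the field. *)
Inductive scalar_kind := RealScalars | ComplexScalars.

Definition rc_field (R : realType) (k : scalar_kind) : numFieldType :=
  match k with RealScalars => R | ComplexScalars => R[i] end.

Definition conjS (R : realType) (k : scalar_kind) :
    {rmorphism rc_field R k -> rc_field R k} :=
  match k return {rmorphism rc_field R k -> rc_field R k} with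
  | RealScalars => idfun
  | ComplexScalars => @conjc R
  end.

Definition ofR (R : realType) (k : scalar_kind) : {rmorphism R -> rc_field R k} :=
  match k return {rmorphism R -> rc_field R k} with
  | RealScalars => idfun
  | ComplexScalars => real_complex R
  end.

Definition reS (R : realType) (k : scalar_kind) : rc_field R k -> R :=
  match k return rc_field R k -> R with
  | RealScalars => fun x => x
  | ComplexScalars => @complex.Re R
  end.
Arguments reS {R k}.
Arguments ofR {R k}.

Section Hilbert.
Variables (R : realType) (k : scalar_kind).
Variables (H : vectType (rc_field R k)) (ip : {dot H for conjS R k}).

Definition hnorm (f : H) : R := Num.sqrt (reS (ip f f)).

Definition orthoproj (X : {vspace H}) : 'End(H) := daddv_pi X (orthov ip X).

Definition is_adjoint (T S : 'End(H)) : Prop :=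
  forall u v : H, ip (T u) v = ip u (S v).

Definition adjoint (T : 'End(H)) : 'End(H) := xget 0 [set S | is_adjoint T S].

Definition trace (T : 'End(H)) : rc_field R k :=
  \sum_(i < \dim {:H}) coord (vbasis {:H}) i (T (vbasis {:H})`_i).

Definition frobenius (T : 'End(H)) : R :=
  Num.sqrt (reS (trace (adjoint T \o T)%VF)).

(* The lemmas up to [adjointP] show that [orthoproj] is the orthogonal
   projection and that [adjoint] is never the default value of [xget]. *)

Lemma dot_eq0 (u : H) : ip u u = 0 -> u = 0.
Proof.
move=> u0; apply/eqP/negPn/negP => /(neq0_dnorm_gt0 (s := ip)).
by rewrite u0 ltxx.
Qed.

Lemma conjSK : involutive (conjS R k).
Proof. by case: k => //= -[a b] /=; rewrite opprK. Qed.

Lemma dotC (u v : H) : ip u v = conjS R k (ip v u).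
Proof. by rewrite (hermC ip) expr0 mul1r. Qed.

Definition gram n (e : 'I_n -> H) (u : H) : 'rV[rc_field R k]_n :=
  \row_i ip u (e i).

Fact gram_linear n (e : 'I_n -> H) : linear (gram e).
Proof. by move=> a u v; apply/rowP => i; rewrite !mxE linearPl. Qed.

HB.instance Definition _ n (e : 'I_n -> H) :=
  GRing.isLinear.Build _ _ _ _ (gram e) (gram_linear e).

Lemma gram_ker n (e : 'I_n -> H) u i :
  u \in lker (linfun (gram e)) -> ip u (e i) = 0.
Proof. by rewrite memv_ker lfunE => /eqP /rowP /(_ i); rewrite !mxE. Qed.

Lemma orthov_cap0 (X : {vspace H}) : (X :&: orthov ip X = 0)%VS.
Proof.
apply/eqP; rewrite -subv0; apply/subvP => u; rewrite memv_cap => /andP[uX].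
by move=> /mem_orthovP /(_ u uX) /dot_eq0 ->; rewrite mem0v.
Qed.

Lemma orthov_addT (X : {vspace H}) : (X + orthov ip X = fullv)%VS.
Proof.
apply/eqP; rewrite eqEdim subvf /= dimv_disjoint_sum ?orthov_cap0 //.
pose e i : H := (vbasis X)`_i.
pose L := linfun (gram (fun i : 'I_(\dim X) => e i)).
have kerL : (lker L <= orthov ip X)%VS.
  apply/subvP => u /gram_ker u0; apply/mem_orthovP => v /coord_vbasis ->.
  rewrite linear_sumr big1 // => i _.
  by rewrite linearZr /= (u0 i) mulr0.
rewrite -(limg_ker_dim L) capfv addnC leq_add ?dimvS //.
by rewrite (leq_trans (dimvS (subvf _))) // dimvf /dim /= mul1n.
Qed.

Lemma orthoprojP (X : {vspace H}) (f : H) :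
  orthoproj X f \in X /\ f - orthoproj X f \in orthov ip X.
Proof.
split; first exact: memv_pi.
have := daddv_pi_add (orthov_cap0 X) (w := f).
rewrite orthov_addT memvf => /(_ isT) fE.
by rewrite -{1}fE addrC addKr memv_pi.
Qed.

Lemma dot_represent (phi : {linear H -> rc_field R k | *%R}) :
  exists s : H, forall u, phi u = ip u s.
Proof.
pose e i : H := (vbasis {:H})`_i.
pose L := linfun (gram (fun i : 'I_(\dim {:H}) => e i)).
have kerL : lker L = 0%VS.
  apply/eqP; rewrite -subv0; apply/subvP => u /gram_ker u0.
  suff /dot_eq0 -> : ip u u = 0 by rewrite mem0v.
  rewrite {2}(coord_vbasis (memvf u)) linear_sumr big1 // => i _.
  by rewrite linearZr /= (u0 i) mulr0.
have dimL : \dim (limg L) = \dim {:H}.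
  by have := limg_ker_dim L fullv; rewrite kerL capv0 dimv0 add0n.
have imL : limg L = fullv.
  apply/eqP; rewrite eqEdim subvf dimL.
  by rewrite [leqLHS]dimvf /dim /= mul1n.
have : \row_(i < \dim {:H}) conjS R k (phi (e i)) \in limg L by rewrite imL memvf.
case/memv_imgP => s _ /rowP sE; exists s => u.
rewrite (coord_vbasis (memvf u)) linear_sum linear_sumlz.
apply: eq_bigr => i _; rewrite linearZ linearZl_LR /=; congr (_ * _).
by rewrite dotC; have := sE i; rewrite lfunE !mxE => <-; rewrite conjSK.
Qed.

Lemma adjointP (T : 'End(H)) : is_adjoint T (adjoint T).
Proof.
suff [S TS] : exists S : 'End(H), is_adjoint T S.
  exact: (xgetPex 0 (ex_intro _ S TS)).
have inj (s t : H) : (forall u, ip u s = ip u t) -> s = t.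
  move=> st; apply/eqP; rewrite -subr_eq0; apply/eqP/dot_eq0.
  by rewrite linearBr /= st subrr.
have rep v : exists s : H, forall u, ip (T u) v = ip u s.
  have lin : linear_for *%R (fun u => ip (T u) v).
    by move=> a x y; rewrite linearP linearPl.
  exact: (dot_represent (HB.pack (fun u => ip (T u) v)
    (GRing.isLinear.Build _ _ _ _ (fun u => ip (T u) v) lin))).
have [S SE] := boolp.choice rep.
have Slin : linear S.
  move=> a x y; apply: inj => u.
  by rewrite -SE !linearPr /= !SE.
pose S' : {linear H -> H} := HB.pack S (GRing.isLinear.Build _ _ _ _ S Slin).
by exists (linfun S') => u v; rewrite lfunE /= SE.
Qed.
End Hilbert.

Record weighted_family (R : realType) (k : scalar_kind)
    (H : vectType (rc_field R k)) (m : nat) := WeightedFamily {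
  subspace :> 'I_m -> {vspace H};
  weight : 'I_m -> R;
  weight_gt0 : forall i, 0 < weight i
}.

Section FusionFrames.
Variables (R : realType) (k : scalar_kind).
Variables (H : vectType (rc_field R k)) (ip : {dot H for conjS R k}).
Variables (m : nat).
Implicit Types (W V Z : weighted_family H m) (L : {set 'I_m}).

Definition span_over W L : {vspace H} := (\sum_(i in L) W i)%VS.

(* Includes the standing non-triviality assumption. *)
Definition fusion_frame W : Prop :=
  span_over W [set: 'I_m]%SET = fullv /\ exists i, W i <> fullv.

Definition frame_op W : 'End(H) :=
  \sum_(i < m) ofR (weight W i ^+ 2) *: orthoproj ip (W i).

Definition dual_term W V (i : 'I_m) : 'End(H) :=
  (orthoproj ip (V i) \o ((frame_op W)^-1 \o orthoproj ip (W i)))%VF.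

Definition dual_fusion_frame W V : Prop :=
  \sum_(i < m) ofR (weight W i * weight V i) *: dual_term W V i = \1%VF.

(* [\big[Num.max/0]] is the maximum since all terms are nonnegative (and m > 0
   for a fusion frame). *)
Definition max_loss W V : R :=
  \big[Num.max/0]_(i < m)
    frobenius ip (ofR (weight W i * weight V i) *: dual_term W V i).

Definition one_loss_optimal_dual W V : Prop :=
  dual_fusion_frame W V /\
  max_loss W V = inf [set max_loss W Z | Z in [set Z | dual_fusion_frame W Z]].

(* [W] restricted to [L] is a Riesz fusion basis of [K]; the weights play no
   role in this notion. *)
Definition riesz_fusion_basis W L (K : {vspace H}) : Prop :=
  span_over W L = K /\
  exists A B : R, [/\ 0 < A, A <= B &
    forall (J : {set 'I_m}) (f : 'I_m -> H),
      J \subset L -> (forall i, i \in J -> f i \in W i) ->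
      A * \sum_(i in J) hnorm ip (f i) ^+ 2
        <= hnorm ip (\sum_(i in J) f i) ^+ 2
        <= B * \sum_(i in J) hnorm ip (f i) ^+ 2].

Definition weighted_norm W V (i : 'I_m) : R :=
  weight W i * weight V i * frobenius ip (dual_term W V i).

Definition loss_const W V : R := \big[Num.max/0]_(i < m) weighted_norm W V i.

Definition Lambda1 W V : {set 'I_m} :=
  [set i | weighted_norm W V i == loss_const W V]%SET.

Definition Lambda2 W V : {set 'I_m} := (~: Lambda1 W V)%SET.

End FusionFrames.

(* Main.v *)
(** The hypotheses make each [W j], [j] in [Lambda1], a direct summand
    complementary to the span of all the other subspaces.  Since
    [sum_i w_i^2 pi_(W i) S^-1 = 1], for [f] in such a [W j] one gets
    [pi_(W j) S^-1 f = w_j^-2 f] and [pi_(W i) S^-1 f = 0] for [i <> j].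
    Evaluating the duality identity of an arbitrary dual [(Z, z)] at [S^-1 f]
    gives [w_j z_j pi_(Z j) S^-1 f = w_j^2 S^-1 f].  Hence the [j]-th term is the
    same for all duals, and it already realizes the maximal loss of [V]. *)
Require Import Defs.
From mathcomp Require Import all_boot all_order all_algebra.
From mathcomp Require Import complex boolp classical_sets reals.

Set Implicit Arguments.
Unset Strict Implicit.
Unset Printing Implicit Defensive.

Import Order.TTheory GRing.Theory Num.Theory.

Local Open Scope ring_scope.

Section Scalars.
Variables (R : realType) (k : scalar_kind).

Lemma reS_ge0 (x : rc_field R k) : 0 <= x -> 0 <= reS x.
Proof. by case: k x => //= -[a b]; rewrite lecE /= => /andP[]. Qed.

Lemma reS_eq0 (x : rc_field R k) : 0 <= x -> reS x = 0 -> x = 0.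
Proof.
by case: k x => //= -[a b]; rewrite lecE /= => /andP[/eqP -> _] ->.
Qed.

Lemma reS_ofRM (a : R) (x : rc_field R k) : reS (ofR a * x) = a * reS x.
Proof. by case: k x => //= -[b c] /=; rewrite mul0r subr0. Qed.

Lemma ofR_gt0 (a : R) : 0 < a -> 0 < (ofR a : rc_field R k).
Proof. by case: k => //= a_gt0; rewrite ltcE /= eqxx. Qed.

Lemma conjS_ofR (a : R) : conjS R k (ofR a) = ofR a.
Proof. by case: k => //=; rewrite oppr0. Qed.
End Scalars.

Section Hilbert.
Variables (R : realType) (k : scalar_kind).
Variables (H : vectType (rc_field R k)) (ip : {dot H for conjS R k}).

Lemma ip_ge0 (u : H) : 0 <= ip u u.
Proof.
by have [->|/(neq0_dnorm_gt0 (s := ip))/ltW//] := eqVneq u 0; rewrite linear0l.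
Qed.

Lemma hnorm_sqr_eq0 (u : H) : hnorm ip u ^+ 2 = 0 -> u = 0.
Proof.
rewrite sqr_sqrtr ?reS_ge0 ?ip_ge0// => /reS_eq0 u0.
by apply: (@dot_eq0 _ _ _ ip); rewrite u0 ?ip_ge0.
Qed.

Lemma ip_inj (s t : H) : (forall u, ip u s = ip u t) -> s = t.
Proof.
move=> st; apply/eqP; rewrite -subr_eq0; apply/eqP/(@dot_eq0 _ _ _ ip).
by rewrite linearBr /= st subrr.
Qed.

Lemma ip_orthoproj (X : {vspace H}) (f u : H) :
  u \in X -> ip u (orthoproj ip X f) = ip u f.
Proof.
move=> uX; have [_ /mem_orthovP/(_ u uX) fX] := orthoprojP ip X f.
by apply/eqP; rewrite eq_sym -subr_eq0 -linearBr /= dotC fX rmorph0.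
Qed.

(** Real scalars are fixed by conjugation, so they leave either slot of [ip] unchanged. Since
    [adjoint] is a chosen value, the two sides are compared through [ip_inj], by pairing with every
    [u]. *)
Lemma adjoint_scale (a : R) (T : 'End(H)) :
  adjoint ip (ofR a *: T) = ofR a *: adjoint ip T.
Proof.
apply/lfunP => v; apply: ip_inj => u.
rewrite -(adjointP ip (ofR a *: T)) !scale_lfunE linearZl_LR /=.
by rewrite linearZr /= conjS_ofR adjointP.
Qed.

Lemma trace_scale (a : rc_field R k) (T : 'End(H)) :
  trace (a *: T) = a * trace T.
Proof.
rewrite /trace mulr_sumr; apply: eq_bigr => i _.
by rewrite scale_lfunE linearZ.
Qed.

Lemma frobenius_ge0 (T : 'End(H)) : 0 <= frobenius ip T.
Proof. exact: sqrtr_ge0. Qed.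

Lemma frobenius_scale (a : R) (T : 'End(H)) :
  0 <= a -> frobenius ip (ofR a *: T) = a * frobenius ip T.
Proof.
move=> a_ge0; rewrite /frobenius adjoint_scale -comp_lfunZl -comp_lfunZr scalerA.
rewrite -rmorphM trace_scale reS_ofRM sqrtrM ?mulr_ge0//.
by rewrite -expr2 sqrtr_sqr ger0_norm.
Qed.
End Hilbert.

Section FusionFrames.
Variables (R : realType) (k : scalar_kind).
Variables (H : vectType (rc_field R k)) (ip : {dot H for conjS R k}).
Variables (m : nat).
Implicit Types (W V Z : weighted_family H m) (L : {set 'I_m}).

(** Pairing the sum with [f] gives [sum_i w_i^2 |pi_(W i) f|^2 = 0], where every term is
    nonnegative. *)
Lemma orthoproj_sum_eq0 W L (f : H) :
  \sum_(i in L) ofR (weight W i ^+ 2) *: orthoproj ip (W i) f = 0 ->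
  forall i, i \in L -> orthoproj ip (W i) f = 0.
Proof.
move=> sum0.
have sqr_gt0 i : 0 < (ofR (weight W i ^+ 2) : rc_field R k).
  by rewrite ofR_gt0// exprn_gt0// weight_gt0.
pose F i := ofR (weight W i ^+ 2) *
  ip (orthoproj ip (W i) f) (orthoproj ip (W i) f).
have F_ge0 i : i \in L -> 0 <= F i.
  by move=> _; rewrite mulr_ge0 ?ip_ge0// ltW.
have FE : \sum_(i in L) F i = 0.
  transitivity (ip 0 f); last exact: linear0l.
  rewrite -sum0 linear_sumlz; apply: eq_bigr => i _.
  rewrite /F linearZl_LR /= ip_orthoproj //; exact: (orthoprojP ip (W i) f).1.
move=> i iL; move/eqP: FE; rewrite psumr_eq0// => /allP/(_ i).
rewrite mem_index_enum iL mulf_eq0 gt_eqF//= => /(_ isT)/eqP.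
exact: dot_eq0.
Qed.

Lemma frame_opE W (f : H) :
  frame_op ip W f =
  \sum_(i < m) ofR (weight W i ^+ 2) *: orthoproj ip (W i) f.
Proof.
by rewrite sum_lfunE; apply: eq_bigr => i _; rewrite scale_lfunE.
Qed.

(** A vector of the kernel is orthogonal to every [W i]; being itself a sum of vectors of the [W i],
    it is orthogonal to itself. Injectivity makes the total operation [^-1] a true inverse of the
    frame operator. *)
Lemma lker_frame_op W :
  span_over W [set: 'I_m]%SET = fullv -> lker (frame_op ip W) == 0%VS.
Proof.
move=> spanW; rewrite -subv0; apply/subvP => f.
rewrite memv_ker frame_opE => /eqP sum0; rewrite memv0; apply/eqP.
have proj0 i : orthoproj ip (W i) f = 0.
  apply: (@orthoproj_sum_eq0 W [set: 'I_m]%SET); rewrite ?inE//.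
  by rewrite -[RHS]sum0; apply: eq_bigl => j; rewrite inE.
have : f \in span_over W [set: 'I_m]%SET by rewrite spanW memvf.
case/memv_sumP => g gW fE; apply: (@dot_eq0 _ _ _ ip).
rewrite {1}fE linear_sumlz big1// => i iT.
by rewrite -[LHS](ip_orthoproj ip f (gW i iT)) proj0 linear0r.
Qed.

(** The identity [S S^-1 f = f] expands [f] into vectors [F i] of the [W i], and [f] in [W j] is
    another such expansion. The assumptions on [L] force the two to agree term by term. *)
Lemma orthoproj_frame_opV W L (j : 'I_m) (f : H) :
  span_over W [set: 'I_m]%SET = fullv ->
  riesz_fusion_basis ip W L (span_over W L) ->
  (span_over W L :&: span_over W (~: L)%SET = 0)%VS ->
  j \in L -> f \in W j ->
  forall i, ofR (weight W i ^+ 2) *: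
    orthoproj ip (W i) ((frame_op ip W)^-1%VF f) = if i == j then f else 0.
Proof.
move=> spanW [_ [A [B [A_gt0 _ riesz]]]] cap0 jL fWj.
set h := (_^-1)%VF f.
pose F i := ofR (weight W i ^+ 2) *: orthoproj ip (W i) h.
pose g i := F i - (if i == j then f else 0).
have FW i : F i \in W i by rewrite memvZ// (orthoprojP ip (W i) h).1.
have gW i : g i \in W i.
  by rewrite memvB//; case: eqP => [->//|_]; rewrite mem0v.
have fE : \sum_(i in L) F i + \sum_(i in (~: L)%SET) F i = f.
  rewrite -[RHS](lker0_lfunVK (lker_frame_op spanW)) frame_opE.
  by rewrite [RHS](bigID (mem L)) /=; congr (_ + _); apply: eq_bigl => i;
    rewrite inE.
have gE : \sum_(i in L) g i = - \sum_(i in (~: L)%SET) F i.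
  have -> : \sum_(i in L) g i = \sum_(i in L) F i - f.
    rewrite sumrB; congr (_ - _); rewrite (bigD1 j)//= eqxx big1 ?addr0//.
    by move=> i /andP[_ /negbTE->].
  by rewrite -fE opprD addrA subrr add0r.
(* The sum lies in the span over [L], and by [gE] also in the span over its complement. *)
have g0 : \sum_(i in L) g i = 0.
  apply/eqP; rewrite -memv0 -cap0 memv_cap {2}gE memvN.
  by rewrite !memv_sumr.
have F0 : \sum_(i in (~: L)%SET) F i = 0 by apply: oppr_inj; rewrite -gE g0 oppr0.
(* The lower Riesz bound, taken with [J = L], turns the vanishing sum into vanishing summands. *)
have hnorm_g0 : \sum_(i in L) hnorm ip (g i) ^+ 2 = 0.
  have /andP[+ _] := riesz L g (subxx L) (fun i _ => gW i).
  rewrite g0 {2}/hnorm linear0l.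
  have -> : reS (0 : rc_field R k) = 0 by case: (k).
  rewrite sqrtr0 expr0n /= pmulr_rle0// => le0.
  by apply/eqP; rewrite eq_le le0 sumr_ge0// => i _; rewrite sqr_ge0.
move=> i; have [iL|iL] := boolP (i \in L).
  apply/eqP; rewrite -subr_eq0; apply/eqP.
  apply: (@hnorm_sqr_eq0 _ _ _ ip); move/eqP: hnorm_g0.
  rewrite psumr_eq0 => [/allP/(_ i)|? _]; last exact: sqr_ge0.
  by rewrite mem_index_enum iL => /(_ isT)/eqP.
(* Off [L] the subspaces may be dependent; the [F i] vanish there because they are positive
   multiples of projections of the single vector [h]. *)
rewrite (orthoproj_sum_eq0 F0) ?inE// scaler0.
by case: eqP iL => [->|//]; rewrite jL.
Qed.

(** The point is that the right-hand side does not mention [Z], so any two duals share this term. *)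
Lemma dual_term_unique W Z L (j : 'I_m) :
  span_over W [set: 'I_m]%SET = fullv ->
  riesz_fusion_basis ip W L (span_over W L) ->
  (span_over W L :&: span_over W (~: L)%SET = 0)%VS ->
  dual_fusion_frame ip W Z -> j \in L ->
  ofR (weight W j * weight Z j) *: dual_term ip W Z j =
  ofR (weight W j ^+ 2) *: ((frame_op ip W)^-1 \o orthoproj ip (W j))%VF.
Proof.
move=> spanW riesz cap0 dualZ jL; apply/lfunP => u.
rewrite !scale_lfunE !comp_lfunE /=.
set f := orthoproj ip (W j) u.
have fW : f \in W j := (orthoprojP ip (W j) u).1.
set h := (_^-1)%VF f.
have projE := orthoproj_frame_opV spanW riesz cap0 jL fW.
have w_neq0 i : ofR (weight W i ^+ 2) != 0 :> rc_field R k.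
  by rewrite gt_eqF// ofR_gt0// exprn_gt0// weight_gt0.
have proj0 i : i != j -> orthoproj ip (W i) h = 0.
  move=> /negbTE ij; apply/eqP; move/eqP: (projE i).
  by rewrite ij scaler_eq0 (negbTE (w_neq0 i)).
have projj : orthoproj ip (W j) h = (ofR (weight W j ^+ 2))^-1 *: f.
  by have := projE j; rewrite eqxx => <-; rewrite scalerA mulVf// scale1r.
(* Duality evaluated at [h]: only the [j]-th term survives, and there [S^-1] sends
   [pi_(W j) h = w_j^-2 f] back to [w_j^-2 h]. *)
have hE : ofR (weight W j ^+ 2) *: h =
    ofR (weight W j * weight Z j) *: orthoproj ip (Z j) h.
  rewrite -[in LHS](id_lfunE h) -[in LHS]dualZ sum_lfunE (bigD1 j)//= big1.
    rewrite addr0 scale_lfunE !comp_lfunE /= projj !linearZ /= -/h.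
    by rewrite !scalerA divfK.
  by move=> i ij; rewrite scale_lfunE !comp_lfunE /= (proj0 i ij) !linear0.
exact: esym.
Qed.

Lemma weighted_normE W V (i : 'I_m) :
  frobenius ip (ofR (weight W i * weight V i) *: dual_term ip W V i) =
  weighted_norm ip W V i.
Proof. by rewrite frobenius_scale// mulr_ge0// ltW// weight_gt0. Qed.

Lemma max_lossE W V : max_loss ip W V = loss_const ip W V.
Proof. by apply: eq_bigr => i _; exact: weighted_normE. Qed.

Lemma loss_const_attained W V (i0 : 'I_m) : exists j, j \in Lambda1 ip W V.
Proof.
have ge0 i : 0 <= weighted_norm ip W V i.
  by rewrite -weighted_normE frobenius_ge0.
exists [arg max_(i > i0) weighted_norm ip W V i]%O.
rewrite inE; case: arg_maxP => // j _ jmax.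
(* The default value 0 of the maximum also has to lie below the attained norm, which is [ge0]. *)
rewrite eq_le le_bigmax /=; exact: bigmax_le.
Qed.

Lemma inf_min (A : set R) (x : R) : A x -> lbound A x -> inf A = x.
Proof.
move=> Ax lbx; apply/eqP; rewrite eq_le; apply/andP; split.
  by apply: ge_inf => //; exists x.
by apply: lb_le_inf => //; exists x.
Qed.
End FusionFrames.

Theorem proposition4p1 (R : realType) (k : scalar_kind)
    (H : vectType (rc_field R k)) (ip : {dot H for conjS R k}) (m : nat)
    (W V : weighted_family H m) :
  fusion_frame W ->
  dual_fusion_frame ip W V ->
  let H1 := span_over W (Lambda1 ip W V) in
  let H2 := span_over W (Lambda2 ip W V) in
  riesz_fusion_basis ip W (Lambda1 ip W V) H1 ->
  (H1 :&: H2 = 0)%VS ->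
  one_loss_optimal_dual ip W V.
Proof.
move=> [spanW [i0 _]] dualV /= riesz cap0; split=> //.
(* The index [i0] from non-triviality shows that there is an index at all, so the maximum is
   attained at some [j]. *)
have [j jL] := loss_const_attained ip W V i0.
apply/esym/inf_min; first by exists V.
move=> _ [Z dualZ <-].
have /eqP Vj : weighted_norm ip W V j == loss_const ip W V by rewrite inE in jL.
(* The loss of [V] is the norm of its [j]-th term, which is also the [j]-th term of [Z] and so is at
   most the loss of [Z]. *)
rewrite max_lossE -Vj -weighted_normE (dual_term_unique spanW riesz cap0 dualV)//.
rewrite -(dual_term_unique spanW riesz cap0 dualZ)//.
exact: (le_bigmax 0 (fun i => frobenius ip (_ *: dual_term ip W Z i)) j).
Qed.
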